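(* $\mathbf P_{\mathrm{IS}}=\mathrm{P/poly}$, where each Boolean function family $(f_n)_{n\in\mathbb N}$ is identified with the unique function $f:\mathbb B^*\to\mathbb B$ such that $f(w)=f_n(w)$ for each $n$ and $w\in\mathbb B^n$.
   Context: Let $\mathbb B=\{\mathsf T,\mathsf F\}$. There are Boolean registers named $\mathtt{in}{:}i$ ($i\ge1$), $\mathtt{aux}{:}i$ ($i\ge1$) and $\mathtt{out}$, processing methods $\mathtt{set{:}T}$ (content becomes $\mathsf T$, reply $\mathsf T$), $\mathtt{set{:}F}$ (content becomes $\mathsf F$, reply $\mathsf F$), $\mathtt{get}$ (no change, reply is the content). Basic instructions are $f.m$ ($f$ register name, $m$ method). Primitive instructions: for each basic instruction $a$, the plain instruction $a$, positive test $+a$, negative test $-a$; forward jumps $\#l$ ($l\in\mathbb N$); termination $!$. An instruction sequence is a finite non-empty sequence $X=u_1;\dots;u_k$ of primitive instructions, $|X|=k$. Execution starts at $u_1$: $a$ executes $a$ and proceeds with the next instruction; $+a$ executes $a$ and proceeds with the next instruction if the reply is $\mathsf T$, otherwise skips the next instruction and proceeds with the one after; $-a$ likewise with reply roles reversed; $\#l$ proceeds with the $l$-th next instruction ($\#0$ causes inaction); $!$ terminates; if there is no instruction to proceed with, inaction occurs. $\mathcal{IS}_{br}$ is the set of instruction sequences whose basic instructions are all of the forms $\mathtt{in}{:}i.\mathtt{get}$, $\mathtt{aux}{:}i.\mathtt{get}$, $\mathtt{aux}{:}i.\mathtt{set{:}}b$, $\mathtt{out}.\mathtt{set{:}}b$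 ($b\in\mathbb B$). $X$ computes $f:\mathbb B^n\to\mathbb B$ if for all $b_1,\dots,b_n$, executing $X$ with $\mathtt{in}{:}i$ initially $b_i$ ($i\le n$) and all auxiliary registers and $\mathtt{out}$ initially $\mathsf F$, execution never executes an instruction on $\mathtt{in}{:}i$ with $i>n$, ends by executing $!$, and leaves $f(b_1,\dots,b_n)$ in $\mathtt{out}$. A Boolean function family is a sequence $(f_n)_{n\in\mathbb N}$ with $f_n:\mathbb B^n\to\mathbb B$. $\mathbf P_{\mathrm{IS}}$ is the class of Boolean function families $(f_n)$ for which there is a polynomial $h:\mathbb N\to\mathbb N$ such that for every $n$ some $X\in\mathcal{IS}_{br}$ computes $f_n$ with $|X|\le h(n)$. $\mathrm{P/poly}$ is the standard non-uniform complexity class (functions computable by polynomial-size Boolean circuit families). *)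

(* Defs.v *)
From HB Require Import structures.
From mathcomp Require Import all_boot all_order all_algebra.
From mathcomp Require Import boolp classical_sets.

Set Implicit Arguments.
Unset Strict Implicit.
Unset Printing Implicit Defensive.

Local Open Scope classical_set_scope.

(* Registers are numbered from 0: [In i] is in:(i+1) and [Aux i] is aux:(i+1). *)
Inductive register := In of nat | Aux of nat | Out.

Definition register_code (r : register) : nat + nat + unit :=
  match r with
  | In i => inl (inl i)
  | Aux i => inl (inr i)
  | Out => inr tt
  end.

Definition register_decode (c : nat + nat + unit) : register :=
  match c with
  | inl (inl i) => In i
  | inl (inr i) => Aux i
  | inr _ => Out
  end.

Lemma register_codeK : cancel register_code register_decode.
Proof. by case. Qed.

HB.instance Definition _ := Equality.copy register (can_type register_codeK).

Inductive method := SetTo of bool | Get.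

Record basic := Basic { focus : register; meth : method }.

Inductive instr :=
| Plain of basic
| PosTest of basic
| NegTest of basic
| Jump of nat
| Term.

(* The new content of a register and its reply, from its current content. *)
Definition process (m : method) (c : bool) : bool * bool :=
  match m with
  | SetTo b => (b, b)
  | Get => (c, c)
  end.

Definition state := register -> bool.

Definition new_state (a : basic) (s : state) : state :=
  [eta s with focus a |-> (process (meth a) (s (focus a))).1].

Definition reply (a : basic) (s : state) : bool :=
  (process (meth a) (s (focus a))).2.

(* [None] stands for both termination and inaction; they are told apart by    *)
(* whether the instruction at the current position is [Term].                 *)
Definition step (X : seq instr) (c : nat * state) : option (nat * state) :=
  let: (pc, s) := c in
  match onth X pc with
  | Some (Plain a) => Some (pc.+1, new_state a s)
  | Some (PosTest a) =>
      Some (if reply a s then pc.+1 else pc.+2, new_state a s)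
  | Some (NegTest a) =>
      Some (if reply a s then pc.+2 else pc.+1, new_state a s)
  | Some (Jump l) => if l == 0 then None else Some (pc + l, s)
  | Some Term => None
  | None => None
  end.

Definition run (X : seq instr) (s : state) (k : nat) : option (nat * state) :=
  iter k (obind (step X)) (Some (0, s)).

Definition instr_basic (u : instr) : option basic :=
  match u with
  | Plain a | PosTest a | NegTest a => Some a
  | Jump _ | Term => None
  end.

Definition basic_br (a : basic) : bool :=
  match focus a, meth a with
  | In _, Get => true
  | Aux _, Get => true
  | Aux _, SetTo _ => true
  | Out, SetTo _ => true
  | _, _ => false
  end.

Definition IS_br : set (seq instr) :=
  [set X : seq instr | X <> [::] /\ all (fun u => oapp basic_br true (instr_basic u)) X].

(* The content given to [In i] for [n <= i] is irrelevant: [computes] forbids *)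
(* instructions on these registers.                                           *)
Definition init n (w : n.-tuple bool) : state :=
  fun r => if r is In i then nth false w i else false.

Definition computes (X : seq instr) n (f : n.-tuple bool -> bool) : Prop :=
  forall w : n.-tuple bool,
    (forall k pc s a i, run X (init w) k = Some (pc, s) ->
       obind instr_basic (onth X pc) = Some a -> focus a = In i -> i < n) /\
    (exists k pc s, [/\ run X (init w) k = Some (pc, s),
       onth X pc = Some Term & s Out = f w]).

Definition polynomial_fun (h : nat -> nat) : Prop :=
  exists p : {poly rat}, forall n, ((h n)%:R = p.[n%:R])%R.

Definition bool_family := forall n, n.-tuple bool -> bool.

Definition P_IS : set bool_family :=
  [set f : bool_family | exists2 h : nat -> nat, polynomial_fun h &
     forall n, exists X : seq instr,
       [/\ IS_br X, computes X (f n) & size X <= h n]].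

Definition family_fun (f : bool_family) : seq bool -> bool :=
  fun w => f (size w) (in_tuple w).

Lemma family_funE (f : bool_family) n (w : n.-tuple bool) :
  family_fun f w = f n w.
Proof.
case: w => s sz; rewrite /family_fun /=; have e := eqP sz.
by subst n; congr (f _ _); apply: val_inj.
Qed.

Lemma family_fun_unique (f : bool_family) (g : seq bool -> bool) :
  (forall n (w : n.-tuple bool), g w = f n w) -> g = family_fun f.
Proof. by move=> gE; apply/funext => w; rewrite /family_fun -gE. Qed.

(* A Boolean circuit is an acyclic graph of nodes listed in a topological     *)
(* order; the arguments of a gate are positions of earlier nodes, the last    *)
(* node is the output, and the size is the number of nodes. Without constant  *)
(* nodes there would be no circuit with 0 inputs.                             *)
Inductive node :=
| Input of nat
| Const of bool
| Not of nat
| And of nat & nat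
| Or of nat & nat.

Definition node_ok (n k : nat) (g : node) : bool :=
  match g with
  | Input i => i < n
  | Const _ => true
  | Not i => i < k
  | And i j | Or i j => (i < k) && (j < k)
  end.

Definition is_circuit (n : nat) (C : seq node) : Prop :=
  C <> [::] /\ forall k g, onth C k = Some g -> node_ok n k g.

Definition node_value (w v : seq bool) (g : node) : bool :=
  match g with
  | Input i => nth false w i
  | Const b => b
  | Not i => ~~ nth false v i
  | And i j => nth false v i && nth false v j
  | Or i j => nth false v i || nth false v j
  end.

Definition circuit_values (C : seq node) (w : seq bool) : seq bool :=
  foldl (fun v g => rcons v (node_value w v g)) [::] C.

Definition circuit_value (C : seq node) (w : seq bool) : bool :=
  last false (circuit_values C w).

Definition P_poly : set (seq bool -> bool) :=
  [set g : seq bool -> bool | exists2 h : nat -> nat, polynomial_fun h &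
     forall n, exists C : seq node,
       [/\ is_circuit n C,
           forall w : n.-tuple bool, circuit_value C w = g w
         & size C <= h n]].

(* Main.v *)
(**
A circuit is turned into an instruction sequence by giving the node at position
[k] a block of at most four instructions that sets [Aux k] to [true] exactly
when the node has value [true]; this works because auxiliary registers are
initially [false].

Conversely, jumps only go forward, so an instruction sequence is executed in one
sweep over its positions. For each position [p] a circuit computes, from the
same data for earlier positions, the content of every register when control has
passed all positions before [p], together with the bits "control is at [q]" for
[q >= p]. Passing from [p] to [p.+1] changes the content of one register and at
most two control bits, hence costs a bounded number of gates.
*)
Require Import Defs.
From mathcomp Require Import all_boot all_algebra.
From mathcomp Require Import boolp classical_sets.

Set Implicit Arguments.
Unset Strict Implicit.
Unset Printing Implicit Defensive.

Import GRing.Theory.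

Local Open Scope classical_set_scope.

(** * Runs from an arbitrary configuration *)

Definition reach (X : seq instr) (c c' : nat * state) : Prop :=
  exists k, iter k (obind (step X)) (Some c) = Some c'.

Lemma reach_refl X c : reach X c c.
Proof. by exists 0. Qed.

Lemma reach_step X c c' c'' : step X c = Some c' -> reach X c' c'' -> reach X c c''.
Proof. by move=> cc' [k kE]; exists k.+1; rewrite iterSr /= cc'. Qed.

Lemma reach_trans X c c' c'' : reach X c c' -> reach X c' c'' -> reach X c c''.
Proof. by move=> [k kE] [l lE]; exists (l + k); rewrite iterD kE. Qed.

Lemma iter_halt X c k : step X c = None ->
  iter k (obind (step X)) (Some c) = if k == 0 then Some c else None.
Proof. by move=> cN; elim: k => //= k ->; case: k. Qed.

(** Execution is deterministic, and iterating past a halted configuration gives [None], so the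
    longer of the two runs cannot be strictly longer. *)
Lemma reach_halt_unique X c c1 c2 : reach X c c1 -> reach X c c2 ->
  step X c1 = None -> step X c2 = None -> c1 = c2.
Proof.
move=> [k kE] [l lE].
wlog kl : k l c1 c2 kE lE / k <= l => [wl h1 h2|h1 h2].
  by case/orP: (leq_total k l) => ?; [|apply: esym]; apply: wl; eauto.
by move: lE; rewrite -(subnK kl) iterD kE iter_halt //; case: ifP => // _ [].
Qed.

(** All moves of the control are relative, so a prefix merely shifts positions. *)
Lemma step_cat P X i s :
  step (P ++ X) (size P + i, s) =
  omap (fun c => (size P + c.1, c.2)) (step X (i, s)).
Proof.
rewrite /step onth_cat ltnNge leq_addr /= addKn.
case: (onth X i) => [[a|a|a|[|l]|]|] //=.
- by rewrite addnS.
- by case: ifP; rewrite !addnS.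
- by case: ifP; rewrite !addnS.
- by rewrite addnA.
Qed.

Lemma reach_cat P X i s j s' : reach X (i, s) (j, s') ->
  reach (P ++ X) (size P + i, s) (size P + j, s').
Proof.
move=> [k kE]; exists k.
pose shift (c : nat * state) := (size P + c.1, c.2).
rewrite -[(_ + i, s)]/(shift (i, s)) -[RHS]/(omap shift (Some (j, s'))) -{}kE.
by elim: k => //= k ->; case: (iter k _ _) => [[pc t]|] //; apply: step_cat.
Qed.

Lemma onth_all T (P : pred T) (s : seq T) i x : all P s -> onth s i = Some x -> P x.
Proof. by elim: s i => [|y s IH] [|i] //= /andP[Py /IH Ps] => [[<-]|/Ps]. Qed.

(** * From circuits to instruction sequences *)

(** Here [v] lists the values of the nodes handled so far. The default [false] of [nth] matches the
    initial content of the remaining auxiliary registers, so a node of value [false] needs no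
    write. *)
Definition aux_state (w v : seq bool) : state := fun r =>
  match r with
  | In i => nth false w i
  | Aux i => nth false v i
  | Out => false
  end.

(** Every block is left at its end. [Jump 3] leaves the [And] block when the first argument is
    [false]; [Jump 2] goes straight to [set_aux] when the first argument of [Or] is [true]. *)
Definition gate_code (k : nat) (g : node) : seq instr :=
  let set_aux := Plain (Basic (Aux k) (SetTo true)) in
  match g with
  | Input i => [:: PosTest (Basic (In i) Get); set_aux]
  | Const b => nseq b set_aux
  | Not i => [:: NegTest (Basic (Aux i) Get); set_aux]
  | And i j => [:: NegTest (Basic (Aux i) Get); Jump 3;
                   PosTest (Basic (Aux j) Get); set_aux]
  | Or i j => [:: PosTest (Basic (Aux i) Get); Jump 2;
                  PosTest (Basic (Aux j) Get); set_aux]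
  end.

Fixpoint circuit_code (k : nat) (C : seq node) : seq instr :=
  if C is g :: C' then gate_code k g ++ circuit_code k.+1 C' else [::].

Definition output_code (k : nat) : seq instr :=
  [:: PosTest (Basic (Aux k) Get); Plain (Basic Out (SetTo true)); Term].

Lemma new_state_get r s : new_state (Basic r Get) s = s.
Proof. by apply/funext => x; rewrite /new_state /=; case: eqP => [->|]. Qed.

Lemma aux_state_set w v : new_state (Basic (Aux (size v)) (SetTo true)) (aux_state w v)
  = aux_state w (rcons v true).
Proof.
apply/funext => -[i|i|] //; rewrite /new_state /= nth_rcons.
rewrite (_ : (Aux i == Aux (size v)) = (i == size v)); last first.
  by apply/eqP/eqP => [[]|->].
by case: ltngtP => // /ltnW iv; rewrite nth_default.
Qed.

Lemma aux_state_rcons0 w v : aux_state w (rcons v false) = aux_state w v.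
Proof.
apply/funext => -[i|i|] //=; rewrite nth_rcons.
by case: ltngtP => // [/ltnW iv|->]; rewrite nth_default.
Qed.

Ltac run_gate E F := do ?[exact: reach_refl | apply: reach_step;
  first by rewrite /= ?new_state_get ?aux_state_set /reply /= ?E ?F].

Lemma gate_code_reach w v g Q :
  reach (gate_code (size v) g ++ Q) (0, aux_state w v)
        (size (gate_code (size v) g), aux_state w (rcons v (node_value w v g))).
Proof.
case: g => [i|b|i|i j|i j] /=.
- by case E: (nth false w i); rewrite ?aux_state_rcons0; run_gate E E.
- by case: b; rewrite /= ?aux_state_rcons0; run_gate (erefl true) (erefl true).
- by case E: (nth false v i); rewrite /= ?aux_state_rcons0; run_gate E E.
- by case E: (nth false v i); case F: (nth false v j);
    rewrite /= ?aux_state_rcons0; run_gate E F.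
- by case E: (nth false v i); case F: (nth false v j);
    rewrite /= ?aux_state_rcons0; run_gate E F.
Qed.

(** [circuit_values] with an arbitrary initial list of values, as induction on the circuit
    requires. *)
Definition extend_values (w v : seq bool) (C : seq node) : seq bool :=
  foldl (fun v g => rcons v (node_value w v g)) v C.

Lemma size_extend_values w v C : size (extend_values w v C) = size v + size C.
Proof. by elim: C v => [|g C IH] v /=; rewrite ?addn0 // IH size_rcons addSnnS. Qed.

Lemma circuit_code_reach w v C Q :
  reach (circuit_code (size v) C ++ Q) (0, aux_state w v)
        (size (circuit_code (size v) C), aux_state w (extend_values w v C)).
Proof.
elim: C v => [|g C IH] v /=; first exact: reach_refl.
rewrite -catA size_cat; apply: reach_trans (gate_code_reach _ _ _ _) _.
rewrite -[in X in reach _ X _](addn0 (size _)); apply: reach_cat.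
by rewrite -(size_rcons v (node_value w v g)); apply: IH.
Qed.

(** This syntactic check yields both membership in [IS_br] and the bound on the inputs accessed,
    whatever positions execution visits. *)
Definition instr_ok (n : nat) (u : instr) : bool :=
  if instr_basic u is Some a then
    basic_br a && (if focus a is In i then i < n else true)
  else true.

Lemma gate_code_ok n k l g : node_ok n l g -> all (instr_ok n) (gate_code k g).
Proof. by case: g => [i|[]|i|i j|i j] //= lt_in; rewrite /instr_ok /= lt_in. Qed.

Lemma circuit_code_ok n k C : (forall l g, onth C l = Some g -> node_ok n (k + l) g) ->
  all (instr_ok n) (circuit_code k C).
Proof.
elim: C k => //= g C IH k Cok; rewrite all_cat; apply/andP; split.
  exact: gate_code_ok (Cok 0 g erefl).
by apply: IH => l h Clh; rewrite addSnnS; apply: Cok.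
Qed.

Lemma size_circuit_code k C : size (circuit_code k C) <= 4 * size C.
Proof.
elim: C k => //= g C IH k; rewrite size_cat mulnS leq_add //.
by case: g => [i|[]|i|i j|i j].
Qed.

Definition circuit_program (C : seq node) : seq instr :=
  circuit_code 0 C ++ output_code (size C).-1.

Lemma computes_circuit_program n C f : is_circuit n C ->
  (forall w : n.-tuple bool, circuit_value C w = f w) ->
  IS_br (circuit_program C) /\ computes (circuit_program C) f.
Proof.
move=> [_ Cok] Cf.
have Xok : all (instr_ok n) (circuit_program C).
  by rewrite all_cat (@circuit_code_ok n 0).
split.
  split; first by rewrite /circuit_program; case: circuit_code.
  apply: sub_all Xok => u; rewrite /instr_ok.
  by case: instr_basic => //= a /andP[].
move=> w; split=> [k pc s a i _|].
  case E: (onth _ pc) => [u|] //= ua ai.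
  by have := onth_all Xok E; rewrite /instr_ok ua ai => /andP[].
have init_aux : init w = aux_state w [::].
  by apply/funext => -[i|i|] //=; rewrite nth_nil.
pose v := circuit_values C w; pose s := aux_state w v.
have vE : nth false v (size C).-1 = f w.
  by rewrite -Cf /circuit_value -nth_last size_extend_values.
(* Position 2 of [output_code] holds [Term]. On value [false] the test skips directly to it, and
   [Out] keeps its initial [false]. *)
suff [s' Xs' s'Out] : exists2 s', reach (output_code (size C).-1) (0, s) (2, s') &
    s' Out = f w.
  have [k kE] : reach (circuit_program C) (0, init w)
      (size (circuit_code 0 C) + 2, s').
    rewrite init_aux; apply: reach_trans (circuit_code_reach w [::] C _) _.
    by rewrite -[X in reach _ (X, _) _]addn0; apply: reach_cat.
  exists k, (size (circuit_code 0 C) + 2), s'; split=> //.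
  by rewrite onth_cat ltnNge leq_addr /= addKn.
case: (f w) vE => vE.
  exists (new_state (Basic Out (SetTo true)) s) => //.
  apply: reach_step; first by rewrite /= new_state_get /reply /= vE.
  exact: reach_step (reach_refl _ _).
exists s => //.
by apply: reach_step; [rewrite /= new_state_get /reply /= vE|apply: reach_refl].
Qed.

(** * From instruction sequences to circuits *)

Definition gates_ok (n : nat) (C : seq node) : Prop :=
  forall k g, onth C k = Some g -> node_ok n k g.

Lemma circuit_values_rcons C g w : circuit_values (rcons C g) w =
  rcons (circuit_values C w) (node_value w (circuit_values C w) g).
Proof. exact: foldl_rcons. Qed.

Lemma size_circuit_values C w : size (circuit_values C w) = size C.
Proof. exact: size_extend_values. Qed.

(** * Functions computed by the nodes of one shared circuit *)

Section Computed.
Variable n : nat.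
Implicit Types (C : seq node) (F : set (n.-tuple bool -> bool)).
Implicit Types f : n.-tuple bool -> bool.

Definition computed_at C j f : Prop :=
  forall w : n.-tuple bool, nth false (circuit_values C w) j = f w.

(** The bound on [j] makes it an admissible argument of a gate appended to [C]; [computed_at] alone
    would let the default value pose as a node. *)
Definition computed C f : Prop := exists2 j, j < size C & computed_at C j f.

(* A single circuit is shared by all of [F]: adding one function obtained from  *)
(* members of [F] by a gate costs one node, however large [F] is.              *)
Definition jointly_computable (m : nat) F : Prop :=
  exists C, [/\ gates_ok n C, size C <= m & forall f, F f -> computed C f].

Lemma gates_ok_rcons C g : gates_ok n C -> node_ok n (size C) g ->
  gates_ok n (rcons C g).
Proof.
move=> Cok gok k h; rewrite -cats1 onth_cat; case: ltnP => [_ /Cok//|Ck].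
by move/onth1P => [/eqP]; rewrite subn_eq0 => kC <-; rewrite (@anti_leq k (size C)) ?kC.
Qed.

Lemma jointly_computable_sub m m' F F' : m <= m' -> F' `<=` F ->
  jointly_computable m F -> jointly_computable m' F'.
Proof.
move=> mm' F'F [C [Cok Cm CF]]; exists C; split=> // [|f /F'F /CF//].
exact: leq_trans mm'.
Qed.

(** Appending a node leaves the earlier positions and values intact. The node may depend on [C],
    since the positions of its arguments do. *)
Lemma computed_node m F f :
  (forall C, (forall g, F g -> computed C g) -> exists2 g, node_ok n (size C) g &
     forall w : n.-tuple bool, node_value w (circuit_values C w) g = f w) ->
  jointly_computable m F -> jointly_computable m.+1 (F `|` [set f]).
Proof.
move=> Fnode [C [Cok Cm CF]]; have [g gok gf] := Fnode C CF.
exists (rcons C g); split; rewrite ?size_rcons //; first exact: gates_ok_rcons.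
move=> h [/CF[j jC jh]|->].
  exists j; rewrite ?size_rcons ?ltnS 1?ltnW // => w.
  by rewrite circuit_values_rcons nth_rcons size_circuit_values jC.
exists (size C); rewrite ?size_rcons // => w.
by rewrite circuit_values_rcons nth_rcons size_circuit_values ltnn eqxx.
Qed.

Lemma computed_const m F b : jointly_computable m F ->
  jointly_computable m.+1 (F `|` [set fun=> b]).
Proof. by apply: computed_node => C _; exists (Const b). Qed.

Lemma computed_input m F i : i < n -> jointly_computable m F ->
  jointly_computable m.+1 (F `|` [set fun w : n.-tuple bool => nth false w i]).
Proof. by move=> i_n; apply: computed_node => C _; exists (Input i). Qed.

Lemma computed_not m F f : F f -> jointly_computable m F ->
  jointly_computable m.+1 (F `|` [set fun w => ~~ f w]).
Proof.
move=> Ff; apply: computed_node => C /(_ f Ff)[j jC jf].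
by exists (Not j) => //= w; rewrite jf.
Qed.

Lemma computed_and m F f f' : F f -> F f' -> jointly_computable m F ->
  jointly_computable m.+1 (F `|` [set fun w => f w && f' w]).
Proof.
move=> Ff Ff'; apply: computed_node => C CF.
have [[j jC jf] [k kC kf']] := (CF f Ff, CF f' Ff').
by exists (And j k) => [|w]; rewrite /= ?jC // jf kf'.
Qed.

Lemma computed_or m F f f' : F f -> F f' -> jointly_computable m F ->
  jointly_computable m.+1 (F `|` [set fun w => f w || f' w]).
Proof.
move=> Ff Ff'; apply: computed_node => C CF.
have [[j jC jf] [k kC kf']] := (CF f Ff, CF f' Ff').
by exists (Or j k) => [|w]; rewrite /= ?jC // jf kf'.
Qed.

(** The output has to be the last node, so the node for [f] is copied to the end by the gate
    [And j j]. *)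
Lemma computed_circuit m F f : F f -> jointly_computable m F ->
  exists C, [/\ is_circuit n C, forall w : n.-tuple bool, circuit_value C w = f w
              & size C <= m.+1].
Proof.
move=> Ff [C [Cok Cm /(_ f Ff)[j jC jf]]]; exists (rcons C (And j j)).
split=> [|w|]; last by rewrite size_rcons.
  by split; [case: (C)|apply: gates_ok_rcons; rewrite //= jC].
by rewrite /circuit_value circuit_values_rcons last_rcons /= jf andbb.
Qed.

End Computed.

(* Jumps only go forward, so the execution can be replayed by letting [p] sweep *)
(* once over the positions, making a move only when the control is at [p].      *)
Fixpoint sweep (X : seq instr) (s : state) (p : nat) : nat * state :=
  if p is p'.+1 then
    let c := sweep X s p' in if c.1 == p' then odflt c (step X c) else c
  else (0, s).

Lemma sweepS X s p : sweep X s p.+1 =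
  if (sweep X s p).1 == p then odflt (sweep X s p) (step X (sweep X s p))
  else sweep X s p.
Proof. by []. Qed.

Lemma sweep_reach X s p : reach X (0, s) (sweep X s p).
Proof.
elim: p => [|p IH] /=; first exact: reach_refl.
case: ifP => // _; case E: (step X _) => [c|] //=.
exact: reach_trans IH (reach_step E (reach_refl _ _)).
Qed.

Lemma step_forward X c c' : step X c = Some c' -> c.1 < c'.1.
Proof.
case: c => pc s /=; case: (onth X pc) => [[a|a|a|[|l]|]|] //= [<-] //=.
- by case: ifP.
- by case: ifP.
- by rewrite addnS ltnS leq_addr.
Qed.

Lemma sweep_halt X s : step X (sweep X s (size X)) = None.
Proof.
(* Induction with [size X] generalised to [p]: control is at or beyond [p] unless execution has
   halted. *)
have : size X <= (sweep X s (size X)).1 \/ step X (sweep X s (size X)) = None.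
  elim: (size X) => [|p IH] /=; first by left.
  case: eqP => [cp|/eqP cp].
    case E: (step X _) => [c|] /=; last by right.
    by left; rewrite -[p in p < _]cp; apply: step_forward E.
  by case: IH => [pc|]; [left; rewrite ltn_neqAle eq_sym cp|right].
case: (sweep _ _ _) => pc t [] //= pcX.
by rewrite onth_default.
Qed.

(** * Circuits for the successive stages of the sweep *)

Section SweepData.
Variables (n : nat) (X : seq instr).
Notation conf w p := (sweep X (init w) p).

(** Infinitely many indices occur, yet one finite circuit can cover them because many of the
    functions coincide. Constants are included since the reply of a set instruction is constant. *)
Inductive sweep_data (p : nat) : set (n.-tuple bool -> bool) :=
| ControlAt q of p <= q : sweep_data p (fun w => (conf w p).1 == q)
| ContentOf r : sweep_data p (fun w => (conf w p).2 r)
| Constant b : sweep_data p (fun=> b).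

Ltac mem := solve [assumption | apply: Constant | right; reflexivity | left; mem].

(** One node per input and two constants suffice: every other initial content and every initial
    control bit is constant. *)
Lemma sweep_data0 : jointly_computable n.+2 (sweep_data 0).
Proof.
have inputs i : i <= n -> jointly_computable i
    [set f : n.-tuple bool -> bool | exists2 j, j < i & f = fun w => nth false w j].
  elim: i => [_|i IH i_n]; first by exists [::]; split=> [[]||f []].
  apply: jointly_computable_sub (leqnn _) _ (computed_input i_n (IH (ltnW i_n))).
  move=> f [j]; rewrite ltnS leq_eqVlt => /orP[/eqP-> ->|ji ->]; first by right.
  by left; exists j.
apply: jointly_computable_sub (leqnn _) _
  (computed_const true (computed_const false (inputs n (leqnn _)))).
have const b : ([set f : n.-tuple bool -> bool | exists2 j, j < n &
    f = fun w => nth false w j] `|` [set fun=> false] `|` [set fun=> true]) (fun=> b).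
  by case: b; [right|left; right].
move=> _ [q _|[i|i|]|b]; try exact: const.
have [i_n|n_i] := ltnP i n; first by left; left; exists i.
suff -> : (fun w : n.-tuple bool => (conf w 0).2 (In i)) = fun=> false by exact: const.
by apply/funext => w; rewrite /= nth_default ?size_tuple.
Qed.

(** The targets lie beyond [p], so their old control bits are available. The same nine gates are
    added for every [a], [t1] and [t2], and the case analysis only selects among them. *)
Lemma sweep_data_move p m a t1 t2 : p < t1 -> p < t2 ->
  (forall s, step X (p, s) = Some (if reply a s then t1 else t2, new_state a s)) ->
  jointly_computable m (sweep_data p) -> jointly_computable (9 + m) (sweep_data p.+1).
Proof.
move=> pt1 pt2 stepE K0.
have sweepE w : conf w p.+1 = if (conf w p).1 == p then
    (if reply a (conf w p).2 then t1 else t2, new_state a (conf w p).2) else conf w p.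
  rewrite sweepS; case: (conf w p) => pc s; rewrite [fst _]/=.
  by case: eqP => // ->; rewrite stepE.
pose act q (w : n.-tuple bool) := (conf w p).1 == q.
pose st r (w : n.-tuple bool) := (conf w p).2 r.
pose rep (w : n.-tuple bool) := reply a (conf w p).2.
have Dact q : p <= q -> sweep_data p (act q) by apply: ControlAt.
have Dst r : sweep_data p (st r) by apply: ContentOf.
have Drep : sweep_data p rep.
  rewrite /rep /reply; case: (meth a) => [b|] /=.
    exact: Constant.
  exact: ContentOf.
(* [go1] and [go2] say that control leaves [p] for [t1] or [t2]; [st0] and [st1] are the new
   contents of [focus a] after setting it to [false] or [true]. *)
pose go1 w := act p w && rep w.
pose nrep w := ~~ rep w; pose go2 w := act p w && nrep w.
pose act1 w := act t1 w || go1 w; pose act12 w := act1 w || go2 w.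
pose act2 w := act t2 w || go2 w.
pose idle w := ~~ act p w.
pose st0 w := st (focus a) w && idle w.
pose st1 w := st (focus a) w || act p w.
have Dp := Dact p (leqnn p).
have D1 := Dact t1 (ltnW pt1); have D2 := Dact t2 (ltnW pt2).
have Dst_a := Dst (focus a).
pose F1 := sweep_data p `|` [set go1].
have K1 : jointly_computable (1 + m) F1 := computed_and Dp Drep K0.
pose F2 := F1 `|` [set nrep].
have K2 : jointly_computable (2 + m) F2
  by apply: (computed_not (f := rep) _ K1); mem.
pose F3 := F2 `|` [set go2].
have K3 : jointly_computable (3 + m) F3
  by apply: (computed_and (f := act p) (f' := nrep) _ _ K2); mem.
pose F4 := F3 `|` [set act1].
have K4 : jointly_computable (4 + m) F4
  by apply: (computed_or (f := act t1) (f' := go1) _ _ K3); mem.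
pose F5 := F4 `|` [set act12].
have K5 : jointly_computable (5 + m) F5
  by apply: (computed_or (f := act1) (f' := go2) _ _ K4); mem.
pose F6 := F5 `|` [set act2].
have K6 : jointly_computable (6 + m) F6
  by apply: (computed_or (f := act t2) (f' := go2) _ _ K5); mem.
pose F7 := F6 `|` [set idle].
have K7 : jointly_computable (7 + m) F7
  by apply: (computed_not (f := act p) _ K6); mem.
pose F8 := F7 `|` [set st0].
have K8 : jointly_computable (8 + m) F8
  by apply: (computed_and (f := st (focus a)) (f' := idle) _ _ K7); mem.
pose F9 := F8 `|` [set st1].
have K9 : jointly_computable (9 + m) F9
  by apply: (computed_or (f := st (focus a)) (f' := act p) _ _ K8); mem.
apply: jointly_computable_sub (leqnn _) _ K9 => _ [q pq|r|b]; last by mem.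
(* The tests [t1 == q] and [t2 == q] do not depend on [w], so each case reduces to one function;
   [act12] serves [t1 = t2 = q]. *)
- rewrite (_ : (fun w => _) =
    fun w => act q w || go1 w && (t1 == q) || go2 w && (t2 == q)); last first.
    apply/funext => w; rewrite sweepE /go1 /go2 /nrep /rep /act.
    case: (conf w p) => pc s /=; have [->|_] := eqVneq pc p; last by rewrite !orbF.
    by rewrite /= (ltn_eqF pq); case: reply; rewrite /= ?orbF.
  case: (t1 =P q) => [<-|_].
    case: (t2 =P t1) => [_|_].
      by rewrite (_ : (fun w => _) = act12); [mem|apply/funext => w; rewrite !andbT].
    rewrite (_ : (fun w => _) = act1); first by mem.
    by apply/funext => w; rewrite andbT andbF orbF.
  case: (t2 =P q) => [<-|_].
    rewrite (_ : (fun w => _) = act2); first by mem.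
    by apply/funext => w; rewrite andbT andbF orbF.
  rewrite (_ : (fun w => _) = act q); first by have := Dact q (ltnW pq); mem.
  by apply/funext => w; rewrite !andbF !orbF.
- have Dr := Dst r.
  have stE w : (conf w p.+1).2 r = if act p w then new_state a (conf w p).2 r else st r w.
    by rewrite sweepE /act /st; case: ifP.
  under eq_fun do rewrite stE.
  have [ra|ra] := eqVneq r (focus a); last first.
    rewrite (_ : (fun w => _) = st r); first by mem.
    by apply/funext => w; rewrite /new_state /= (negbTE ra) if_same.
  case aE : (meth a) => [[]|].
  + rewrite (_ : (fun w => _) = st1); first by mem.
    apply/funext => w; rewrite /new_state /= ra eqxx aE /= /st1.
    by case: (act p w); rewrite ?orbT ?orbF.
  + rewrite (_ : (fun w => _) = st0); first by mem.
    apply/funext => w; rewrite /new_state /= ra eqxx aE /= /st0 /idle.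
    by case: (act p w); rewrite ?andbT ?andbF.
  + rewrite (_ : (fun w => _) = st r); first by mem.
    by apply/funext => w; rewrite /new_state /= ra eqxx aE /= if_same.
Qed.

Lemma sweep_data_stay p m : (forall s, step X (p, s) = None) ->
  jointly_computable m (sweep_data p) -> jointly_computable m (sweep_data p.+1).
Proof.
move=> stepN; apply: jointly_computable_sub (leqnn m) _.
have sweepE w : conf w p.+1 = conf w p.
  rewrite sweepS; case: (conf w p) => pc s; rewrite [fst _]/=.
  by case: eqP => // ->; rewrite stepN.
move=> _ [q pq|r|b]; last exact: Constant.
  by under eq_fun do rewrite sweepE; apply: ControlAt (ltnW pq).
by under eq_fun do rewrite sweepE; apply: ContentOf.
Qed.

Lemma sweep_data_computable p : jointly_computable (9 * p + n.+2) (sweep_data p).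
Proof.
elim: p => [|p IH]; first exact: sweep_data0.
have move_p a t1 t2 pt1 pt2 stepE := @sweep_data_move p _ a t1 t2 pt1 pt2 stepE IH.
rewrite mulnS -addnA.
case E: (onth X p) => [[a|a|a|[|l]|]|].
- by apply: (move_p a p.+1 p.+1) => // s; rewrite /= E if_same.
- by apply: (move_p a p.+1 p.+2) => // s; rewrite /= E.
- by apply: (move_p a p.+2 p.+1) => // s; rewrite /= E.
- apply: jointly_computable_sub (leq_addl _ _) (fun _ => id) _.
  by apply: sweep_data_stay IH => s; rewrite /= E.
(* A nonzero jump is a move with equal targets, and [Get] leaves the state unchanged. *)
- apply: (move_p (Basic Out Get) (p + l.+1) (p + l.+1)); rewrite ?addnS ?ltnS ?leq_addr //.
  by move=> s; rewrite /= E new_state_get if_same addnS.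
- apply: jointly_computable_sub (leq_addl _ _) (fun _ => id) _.
  by apply: sweep_data_stay IH => s; rewrite /= E.
- apply: jointly_computable_sub (leq_addl _ _) (fun _ => id) _.
  by apply: sweep_data_stay IH => s; rewrite /= E.
Qed.

End SweepData.

(** The complete sweep ends in a halted configuration, which by determinism is the one where [Term]
    is reached; hence its content of [Out] is [f w]. *)
Lemma computes_circuit n X f : @computes X n f ->
  exists C, [/\ is_circuit n C, forall w : n.-tuple bool, circuit_value C w = f w
              & size C <= (9 * size X + n.+2).+1].
Proof.
move=> Xf; apply: computed_circuit (sweep_data_computable n X (size X)).
rewrite (_ : f = fun w => (sweep X (init w) (size X)).2 Out); first exact: ContentOf.
apply/funext => w; have [_ [k [pc [s [kE pcT <-]]]]] := Xf w.
have -> // : sweep X (init w) (size X) = (pc, s).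
apply: (reach_halt_unique (sweep_reach X (init w) (size X)) _ (sweep_halt X _)).
  by exists k.
by rewrite /= pcT.
Qed.

(** * Polynomial bounds and the two inclusions *)

Lemma polynomial_fun_affine a b c h : polynomial_fun h ->
  polynomial_fun (fun n => a * h n + b * n + c).
Proof.
move=> [p hp]; exists (a%:R *: p + b%:R *: 'X + c%:R%:P)%R => n.
by rewrite !hornerE -hp !natrD !natrM.
Qed.

Theorem theorem5 : family_fun @` P_IS = P_poly.
Proof.
apply/seteqP; split=> [_ [f [h hpoly fX] <-]|g [h hpoly gC]].
  exists (fun n => 9 * h n + 1 * n + 3); first exact: polynomial_fun_affine.
  move=> n; have [X [_ /computes_circuit[C [Cok Cf sizeC]] sizeX]] := fX n.
  exists C; split=> // [w|]; first by rewrite Cf family_funE.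
  apply: leq_trans sizeC _.
  by rewrite mul1n -addnA addn3 -addnS leq_add2r leq_mul2l sizeX.
exists (fun n => g : n.-tuple bool -> bool); last by apply/funext.
(* At most four instructions per node, and three for [output_code]. *)
exists (fun n => 4 * h n + 0 * n + 3); first exact: polynomial_fun_affine.
move=> n; have [C [Cok Cg sizeC]] := gC n.
have [Xbr Xg] := computes_circuit_program Cok Cg.
exists (circuit_program C); split=> //.
rewrite size_cat mul0n addn0 leq_add2r.
by apply: leq_trans (size_circuit_code 0 C) _; rewrite leq_mul2l.
Qed.
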